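(* Let $(\mathcal C,\mathcal E,A)$ be an arithmetic exact category, $\widehat{\deg}$ a degree function on $(\mathcal C,\mathcal E,A)$ and $\mathrm{rk}$ a rank function on $(\mathcal C,\mathcal E)$. Suppose that $(\mathcal C,\mathcal E)$ is an Abelian category (i.e. $\mathcal C$ is Abelian and $\mathcal E$ is the class of all short exact sequences). Then $(\mathcal C,\mathcal E,A,\widehat{\deg},\mathrm{rk})$ is a Harder-Narasimhan category if the following conditions are satisfied: 1) for any non-zero arithmetic object $\overline X$, there exists a non-zero arithmetic subobject $\overline Z$ of $\overline X$ such that $$\widehat\mu(\overline Z)=\sup\{\widehat\mu(\overline Y)\;|\;\overline Y\text{ is a non-zero arithmetic subobject of }\overline X\};$$ 2) for any non-zero object $X$ in $\mathcal C$ and any two arithmetic structures $h_X$ and $h_X'$ on $X$, if $\mathrm{Id}_X:(X,h_X)\to(X,h_X')$ is compatible with arithmetic structures, then $\widehat\mu(X,h_X)\le\widehat\mu(X,h_X')$.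
   Context: Exact categories. An exact category $(\mathcal C,\mathcal E)$ is an exact category in the sense of Quillen with $\mathcal C$ essentially small, $\mathcal E$ being its class of distinguished short exact sequences $0\to X'\to X\to X''\to 0$. A morphism occurring as $X'\to X$ (resp. $X\to X''$) in such a sequence is an admissible monomorphism (resp. admissible epimorphism); $X\amalg Y$ is the direct sum. (In the Abelian case these are all monomorphisms, resp. all epimorphisms.) Arithmetic exact categories. An arithmetic structure $A$ on $(\mathcal C,\mathcal E)$ consists of a set $A(X)$ for every object $X$, a map $f^*:A(Y)\to A(X)$ for every admissible monomorphism $f:X\to Y$, and a map $g_*:A(X)\to A(Y)$ for every admissible epimorphism $g:X\to Y$, such that: (A1) $A(0)$ is a one-point set; (A2) $(ji)^*=i^*j^*$ for composable admissible monomorphisms $i,j$; (A3) $(qp)_*=q_*p_*$ for composable admissible epimorphisms $p,q$; (A4) $\mathrm{Id}_X^*=\mathrm{Id}_{X*}=\mathrm{Id}_{A(X)}$; (A5) if $f:X\to Y$ is an isomorphism then $f^*f_*=\mathrm{Id}_{A(X)}$ and $f_*f^*=\mathrm{Id}_{A(Y)}$; (A6) for every cartesian or cocartesian square with $u:X\to Y$, $v:Z\to W$ admissible monomorphisms, $p:X\to Z$, $q:Y\to W$ admissible epimorphisms and $qu=vp$, one has $v^*q_*=p_*u^*$; (A7) if $u:X\to Y$ is an admissible epimorphism, $v:Y\to Z$ an admissible monomorphism and $(h_X,h_Z)\in A(X)\times A(Z)$ satisfies $u_*(h_X)=v^*(h_Z)$, then there is $h\in A(X\amalg Z)$ with $(\mathrm{Id},vu)^*(h)=h_X$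 and $\mathrm{pr}_{2*}(h)=h_Z$. Then $(\mathcal C,\mathcal E,A)$ is called an arithmetic exact category; an arithmetic object is a pair $\overline X=(X,h)$ with $h\in A(X)$ (an element of $A(X)$ is called an arithmetic structure on $X$), and it is non-zero if $X\ne0$. For an admissible monomorphism $i:Y\to X$, $(Y,i^*h)$ is an arithmetic subobject of $(X,h)$; for an admissible epimorphism $p:X\to Z$, $(Z,p_*h)$ is an arithmetic quotient of $(X,h)$. A morphism $f:X'\to X''$ of $\mathcal C$ is compatible with arithmetic structures $h'\in A(X')$, $h''\in A(X'')$ if there are an arithmetic object $(X,h)$, an admissible monomorphism $u:X'\to X$ and an admissible epimorphism $v:X\to X''$ with $f=vu$, $h'=u^*(h)$, $h''=v_*(h)$. Arithmetic objects and compatible morphisms form a category $\mathcal C_A$. Degree, rank, slope. $\mathcal E_A$ is the class of diagrams $0\to(X',h')\xrightarrow{i}(X,h)\xrightarrow{p}(X'',h'')\to0$ with underlying sequence in $\mathcal E$, $h'=i^*h$, $h''=p_*h$. $K_0(\mathcal C,\mathcal E,A)$ is the free abelian group on isomorphism classes of $\mathcal C_A$ modulo the relations $[(X,h)]=[(X',h')]+[(X'',h'')]$ for diagrams in $\mathcal E_A$; $K_0(\mathcal C,\mathcal E)$ is the usual Grothendieck group. A degree function is a group homomorphism $\widehat{\deg}:K_0(\mathcal C,\mathcal E,A)\to\mathbb R$; a rank function is a group homomorphism $\mathrm{rk}:K_0(\mathcal C,\mathcal E)\to\mathbb Z$ with $\mathrm{rk}([X])>0$ for $X\neq0$. For a non-zero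 arithmetic object, $\widehat\mu(X,h)=\widehat{\deg}(X,h)/\mathrm{rk}(X)$; it is semistable if $\widehat\mu(X',h')\le\widehat\mu(X,h)$ for every non-zero arithmetic subobject $(X',h')$. Harder-Narasimhan category. $(\mathcal C,\mathcal E,A,\widehat{\deg},\mathrm{rk})$ is a Harder-Narasimhan category if: (HN1) every non-zero arithmetic object $(X,h)$ has a (non-zero) arithmetic subobject $(X_{\mathrm{des}},h_{\mathrm{des}})$ whose slope equals $\sup\{\widehat\mu(X',h'):(X',h')\text{ a non-zero arithmetic subobject of }(X,h)\}$, and for every non-zero arithmetic subobject $(X_0,h_0)$ of $(X,h)$ with $\widehat\mu(X_0,h_0)=\widehat\mu(X_{\mathrm{des}},h_{\mathrm{des}})$ there is an admissible monomorphism $f:X_0\to X_{\mathrm{des}}$, commuting with the inclusions into $X$, such that $f^*(h_{\mathrm{des}})=h_0$; (HN2) if $(X_1,h_1)$, $(X_2,h_2)$ are semistable with $\widehat\mu(X_1,h_1)>\widehat\mu(X_2,h_2)$, there is no non-zero morphism $X_1\to X_2$ compatible with arithmetic structures. *)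

(* Defs.v *)
From HB Require Import structures.
From mathcomp Require Import all_boot all_order all_algebra ring_quotient.
From mathcomp Require Import freeg.
From mathcomp Require Import boolp classical_sets reals constructive_ereal ereal.

Set Implicit Arguments.
Unset Strict Implicit.
Unset Printing Implicit Defensive.

Import Order.TTheory GRing.Theory Num.Theory.
Local Open Scope classical_set_scope.
Local Open Scope ring_scope.

Declare Scope cat_scope.
Delimit Scope cat_scope with cat.

Record preadd := Preadd {
  obj :> Type;
  mor : obj -> obj -> zmodType;
  idm : forall X, mor X X;
  mcomp : forall X Y Z, mor Y Z -> mor X Y -> mor X Z;
  mcompA : forall X Y Z W (h : mor Z W) (g : mor Y Z) (f : mor X Y),
    mcomp h (mcomp g f) = mcomp (mcomp h g) f;
  mcomp1f : forall X Y (f : mor X Y), mcomp (idm Y) f = f;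
  mcompf1 : forall X Y (f : mor X Y), mcomp f (idm X) = f;
  mcompDl : forall X Y Z (g g' : mor Y Z) (f : mor X Y),
    mcomp (g + g') f = mcomp g f + mcomp g' f;
  mcompDr : forall X Y Z (g : mor Y Z) (f f' : mor X Y),
    mcomp g (f + f') = mcomp g f + mcomp g f'
}.

Arguments mor {p} X Y.
Arguments idm {p} X.
Arguments mcomp {p X Y Z} g f.

Notation "g ∘ f" := (mcomp g f) (at level 40, left associativity) : cat_scope.
Local Open Scope cat_scope.

Definition is_zero (C : preadd) (X : C) : Prop :=
  forall Y : C, (forall f : mor X Y, f = 0) /\ (forall f : mor Y X, f = 0).

Record addcat := Addcat {
  addcat_preadd :> preadd;
  zero_ob : addcat_preadd;
  zero_obP : is_zero zero_ob;
  dsum : addcat_preadd -> addcat_preadd -> addcat_preadd;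
  in1 : forall X Y, mor X (dsum X Y);
  in2 : forall X Y, mor Y (dsum X Y);
  pr1 : forall X Y, mor (dsum X Y) X;
  pr2 : forall X Y, mor (dsum X Y) Y;
  pr1_in1 : forall X Y, pr1 X Y ∘ in1 X Y = idm X;
  pr2_in2 : forall X Y, pr2 X Y ∘ in2 X Y = idm Y;
  pr1_in2 : forall X Y, pr1 X Y ∘ in2 X Y = 0;
  pr2_in1 : forall X Y, pr2 X Y ∘ in1 X Y = 0;
  in_pr : forall X Y,
    in1 X Y ∘ pr1 X Y + in2 X Y ∘ pr2 X Y = idm (dsum X Y)
}.

Arguments zero_ob {a}.
Arguments dsum {a} X Y.
Arguments in1 {a} X Y.
Arguments in2 {a} X Y.
Arguments pr1 {a} X Y.
Arguments pr2 {a} X Y.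

Definition pairing (C : addcat) (T X Y : C) (f : mor T X) (g : mor T Y) :
  mor T (dsum X Y) := in1 X Y ∘ f + in2 X Y ∘ g.

Section MorphismProperties.
Variable C : preadd.

Definition is_iso (X Y : C) (f : mor X Y) : Prop :=
  exists g : mor Y X, g ∘ f = idm X /\ f ∘ g = idm Y.

Definition isomorphic (X Y : C) : Prop := exists f : mor X Y, is_iso f.

Definition mono (X Y : C) (f : mor X Y) : Prop :=
  forall (T : C) (a b : mor T X), f ∘ a = f ∘ b -> a = b.

Definition epi (X Y : C) (f : mor X Y) : Prop :=
  forall (T : C) (a b : mor Y T), a ∘ f = b ∘ f -> a = b.

Definition is_kernel (K X Y : C) (i : mor K X) (f : mor X Y) : Prop :=
  f ∘ i = 0 /\
  forall (T : C) (a : mor T X), f ∘ a = 0 -> exists! t : mor T K, i ∘ t = a.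

Definition is_cokernel (X Y Q : C) (p : mor Y Q) (f : mor X Y) : Prop :=
  p ∘ f = 0 /\
  forall (T : C) (a : mor Y T), a ∘ f = 0 -> exists! t : mor Q T, t ∘ p = a.

Definition short_exact (X' X X'' : C) (i : mor X' X) (p : mor X X'') : Prop :=
  is_kernel i p /\ is_cokernel p i.

(* The square is
       X --u--> Y
       |p       |q
       Z --v--> W     *)
Definition cartesian (X Y Z W : C) (u : mor X Y) (p : mor X Z)
    (q : mor Y W) (v : mor Z W) : Prop :=
  q ∘ u = v ∘ p /\
  forall (T : C) (a : mor T Y) (b : mor T Z), q ∘ a = v ∘ b ->
    exists! t : mor T X, u ∘ t = a /\ p ∘ t = b.

Definition cocartesian (X Y Z W : C) (u : mor X Y) (p : mor X Z)
    (q : mor Y W) (v : mor Z W) : Prop :=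
  q ∘ u = v ∘ p /\
  forall (T : C) (a : mor Y T) (b : mor Z T), a ∘ u = b ∘ p ->
    exists! t : mor W T, t ∘ q = a /\ t ∘ v = b.

End MorphismProperties.

Definition is_abelian (C : addcat) : Prop :=
  [/\ forall (X Y : C) (f : mor X Y), exists (K : C) (i : mor K X), is_kernel i f,
      forall (X Y : C) (f : mor X Y), exists (Q : C) (p : mor Y Q), is_cokernel p f,
      forall (X Y : C) (f : mor X Y), mono f ->
        exists (Z : C) (g : mor Y Z), is_kernel f g &
      forall (X Y : C) (f : mor X Y), epi f ->
        exists (Z : C) (g : mor Z X), is_cokernel f g].

Definition seq_class (C : addcat) :=
  forall X' X X'' : C, mor X' X -> mor X X'' -> Prop.

Definition adm_mono_in (C : addcat) (E : seq_class C) (X Y : C) (f : mor X Y) :=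
  exists (Z : C) (g : mor Y Z), E X Y Z f g.

Definition adm_epi_in (C : addcat) (E : seq_class C) (X Y : C) (f : mor X Y) :=
  exists (Z : C) (g : mor Z X), E Z X Y g f.

(* [ex_obscure_mono] and [ex_obscure_epi] are part of Quillen's original list;
   they are redundant by a theorem of Keller. *)
Record exact_axioms (C : addcat) (E : seq_class C) : Prop := ExactAxioms {
  ex_short : forall (X' X X'' : C) (i : mor X' X) (p : mor X X''),
    E _ _ _ i p -> short_exact i p;
  ex_split : forall X Y : C, E _ _ _ (in1 X Y) (pr2 X Y);
  ex_iso : forall (X' X X'' Y' Y Y'' : C)
      (i : mor X' X) (p : mor X X'') (j : mor Y' Y) (q : mor Y Y'')
      (a' : mor X' Y') (a : mor X Y) (a'' : mor X'' Y''),
    is_iso a' -> is_iso a -> is_iso a'' -> a ∘ i = j ∘ a' -> a'' ∘ p = q ∘ a ->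
    E _ _ _ i p -> E _ _ _ j q;
  ex_comp_mono : forall (X Y Z : C) (g : mor Y Z) (f : mor X Y),
    adm_mono_in E g -> adm_mono_in E f -> adm_mono_in E (g ∘ f);
  ex_comp_epi : forall (X Y Z : C) (g : mor Y Z) (f : mor X Y),
    adm_epi_in E g -> adm_epi_in E f -> adm_epi_in E (g ∘ f);
  ex_pushout : forall (X Y Z : C) (u : mor X Y) (p : mor X Z),
    adm_mono_in E u -> exists (W : C) (q : mor Y W) (v : mor Z W),
      cocartesian u p q v /\ adm_mono_in E v;
  ex_pullback : forall (Y Z W : C) (q : mor Y W) (v : mor Z W),
    adm_epi_in E q -> exists (X : C) (u : mor X Y) (p : mor X Z),
      cartesian u p q v /\ adm_epi_in E p;
  ex_obscure_mono : forall (X Y Z : C) (f : mor X Y) (g : mor Y Z),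
    (exists (Q : C) (p : mor Y Q), is_cokernel p f) ->
    adm_mono_in E (g ∘ f) -> adm_mono_in E f;
  ex_obscure_epi : forall (X Y Z : C) (f : mor X Y) (g : mor Z X),
    (exists (K : C) (i : mor K X), is_kernel i f) ->
    adm_epi_in E (f ∘ g) -> adm_epi_in E f
}.

Record exact_cat := ExactCat {
  exact_addcat :> addcat;
  conflation : seq_class exact_addcat;
  exactP : exact_axioms conflation
}.

Arguments conflation {e X' X X''} _ _.

Definition adm_mono (C : exact_cat) (X Y : C) (f : mor X Y) : Prop :=
  adm_mono_in (@conflation C) f.

Definition adm_epi (C : exact_cat) (X Y : C) (f : mor X Y) : Prop :=
  adm_epi_in (@conflation C) f.

Definition abelian_exact (C : exact_cat) : Prop :=
  is_abelian C /\
  forall (X' X X'' : C) (i : mor X' X) (p : mor X X''),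
    conflation i p <-> short_exact i p.

(* [f^*] and [g_*] exist only for admissible [f], [g], hence the proof
   arguments of [pull] and [push]. *)
Record arith_structure (C : exact_cat) := ArithStructure {
  arith :> C -> Type;
  pull : forall (X Y : C) (f : mor X Y), adm_mono f -> arith Y -> arith X;
  push : forall (X Y : C) (g : mor X Y), adm_epi g -> arith X -> arith Y;
  arith_zero : exists h0 : arith zero_ob, forall h : arith zero_ob, h = h0;
  pull_comp : forall (X Y Z : C) (i : mor X Y) (j : mor Y Z)
      (mi : adm_mono i) (mj : adm_mono j) (mji : adm_mono (j ∘ i)) (h : arith Z),
    pull mji h = pull mi (pull mj h);
  push_comp : forall (X Y Z : C) (p : mor X Y) (q : mor Y Z)
      (ep : adm_epi p) (eq : adm_epi q) (eqp : adm_epi (q ∘ p)) (h : arith X),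
    push eqp h = push eq (push ep h);
  pull_id : forall (X : C) (m : adm_mono (idm X)) (h : arith X), pull m h = h;
  push_id : forall (X : C) (e : adm_epi (idm X)) (h : arith X), push e h = h;
  pull_push_iso : forall (X Y : C) (f : mor X Y) (m : adm_mono f) (e : adm_epi f)
      (h : arith X),
    is_iso f -> pull m (push e h) = h;
  push_pull_iso : forall (X Y : C) (f : mor X Y) (m : adm_mono f) (e : adm_epi f)
      (h : arith Y),
    is_iso f -> push e (pull m h) = h;
  base_change : forall (X Y Z W : C) (u : mor X Y) (p : mor X Z)
      (q : mor Y W) (v : mor Z W)
      (mu : adm_mono u) (mv : adm_mono v) (ep : adm_epi p) (eq : adm_epi q)
      (h : arith Y),
    cartesian u p q v \/ cocartesian u p q v ->
    pull mv (push eq h) = push ep (pull mu h);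
  glue : forall (X Y Z : C) (u : mor X Y) (v : mor Y Z)
      (eu : adm_epi u) (mv : adm_mono v)
      (m : adm_mono (pairing (idm X) (v ∘ u))) (e : adm_epi (pr2 X Z))
      (hX : arith X) (hZ : arith Z),
    push eu hX = pull mv hZ ->
    exists h : arith (dsum X Z), pull m h = hX /\ push e h = hZ
}.

Arguments pull {C} a {X Y f} _ _.
Arguments push {C} a {X Y g} _ _.

Section ArithmeticObjects.
Variables (C : exact_cat) (A : arith_structure C).

Record arith_obj := ArithObj { aob : C; astr : A aob }.

Definition nonzero (X : arith_obj) : Prop := ~ is_zero (aob X).

Definition arith_sub (Y X : arith_obj) (i : mor (aob Y) (aob X)) : Prop :=
  exists m : adm_mono i, astr Y = pull A m (astr X).

Arguments arith_sub Y X i : clear implicits.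

Definition arith_quo (X Z : arith_obj) (p : mor (aob X) (aob Z)) : Prop :=
  exists e : adm_epi p, astr Z = push A e (astr X).

Arguments arith_quo X Z p : clear implicits.

Definition compatible (X' X'' : arith_obj) (f : mor (aob X') (aob X'')) : Prop :=
  exists (X : arith_obj) (u : mor (aob X') (aob X)) (v : mor (aob X) (aob X'')),
    [/\ f = v ∘ u, arith_sub X' X u & arith_quo X X'' v].

Arguments compatible X' X'' f : clear implicits.

(* The inverse is required to be compatible too: this is isomorphism in the
   category of arithmetic objects and compatible morphisms, not in [C]. *)
Definition arith_isomorphic (X Y : arith_obj) : Prop :=
  exists (f : mor (aob X) (aob Y)) (g : mor (aob Y) (aob X)),
    [/\ compatible X Y f, compatible Y X g, g ∘ f = idm (aob X) & f ∘ g = idm (aob Y)].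

Definition arith_exact (X' X X'' : arith_obj) : Prop :=
  exists (i : mor (aob X') (aob X)) (p : mor (aob X) (aob X'')),
    [/\ conflation i p, arith_sub X' X i & arith_quo X X'' p].

End ArithmeticObjects.

Arguments arith_sub {C A} Y X i.
Arguments arith_quo {C A} X Z p.
Arguments compatible {C A} X' X'' f.

(* Free abelian group on the isomorphism classes, a class being a subset of
   [T], divided by the subgroup generated by [X] - [X'] - [X''] for [ses]. *)
Section Grothendieck.
Variables (T : Type) (iso : T -> T -> Prop) (ses : T -> T -> T -> Prop).

Definition iso_class (X : T) : set T := [set Y | iso X Y].

Definition iso_classes : set (set T) := range iso_class.

Lemma mem_iso_class (X : T) : iso_class X \in iso_classes.
Proof. by apply/mem_set; exists X. Qed.

Definition free_group := {freeg iso_classes / int}.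

Definition generator (X : T) : free_group :=
  << exist (fun c => c \in iso_classes) (iso_class X) (mem_iso_class X) >>.

Definition relators : set free_group :=
  [set r | exists X' X X'' : T,
    ses X' X X'' /\ r = generator X - (generator X' + generator X'')].

Definition relator_span : {pred free_group} := fun x =>
  `[< forall S : set free_group,
      S 0 -> (forall a b, S a -> S b -> S (a - b)) -> relators `<=` S -> S x >].

Lemma relator_span_closed : zmod_closed relator_span.
Proof.
split; first by apply/asboolP => S S0 SB SR.
move=> a b /asboolP Sa /asboolP Sb; apply/asboolP => S S0 SB SR.
exact: (SB a b (Sa S S0 SB SR) (Sb S S0 SB SR)).
Qed.

HB.instance Definition _ :=
  GRing.isZmodClosed.Build free_group relator_span relator_span_closed.

Definition K0 : zmodType := Quotient.quot relator_span.

Definition K0_class (X : T) : K0 := (\pi_(Quotient.quot relator_span) (generator X))%qT.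

End Grothendieck.

Definition K0_exact (C : exact_cat) : zmodType :=
  K0 (@isomorphic C)
     (fun X' X X'' : C => exists (i : mor X' X) (p : mor X X''), conflation i p).

Definition K0_arith (C : exact_cat) (A : arith_structure C) : zmodType :=
  K0 (@arith_isomorphic C A) (@arith_exact C A).

Definition class_exact (C : exact_cat) (X : C) : K0_exact C := K0_class _ _ X.

Definition class_arith (C : exact_cat) (A : arith_structure C)
  (X : arith_obj A) : K0_arith A := K0_class _ _ X.

Definition is_rank (C : exact_cat) (rk : {additive K0_exact C -> int}) : Prop :=
  forall X : C, ~ is_zero X -> 0 < rk (class_exact X).

Section Slope.
Variables (R : realType) (C : exact_cat) (A : arith_structure C).
Variables (adeg : {additive K0_arith A -> R}) (rk : {additive K0_exact C -> int}).

(* only meaningful for non-zero [X]: division by 0 is 0 *)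
Definition slope (X : arith_obj A) : R :=
  adeg (class_arith X) / (rk (class_exact (aob X)))%:~R.

(* Valued in [\bar R] so that its supremum is the true one, without a
   boundedness assumption. *)
Definition sub_slopes (X : arith_obj A) : set (\bar R) :=
  [set (slope Y)%:E | Y in
    [set Y | nonzero Y /\ exists i : mor (aob Y) (aob X), arith_sub Y X i]].

Definition semistable (X : arith_obj A) : Prop :=
  nonzero X /\
  forall (Y : arith_obj A) (i : mor (aob Y) (aob X)),
    nonzero Y -> arith_sub Y X i -> slope Y <= slope X.

Definition HN1 : Prop :=
  forall X : arith_obj A, nonzero X ->
  exists (D : arith_obj A) (i : mor (aob D) (aob X)),
    [/\ nonzero D, arith_sub D X i, (slope D)%:E = ereal_sup (sub_slopes X) &
      forall (X0 : arith_obj A) (i0 : mor (aob X0) (aob X)),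
        nonzero X0 -> arith_sub X0 X i0 -> slope X0 = slope D ->
        exists f : mor (aob X0) (aob D), arith_sub X0 D f /\ i ∘ f = i0].

Definition HN2 : Prop :=
  forall X1 X2 : arith_obj A, semistable X1 -> semistable X2 ->
    slope X2 < slope X1 ->
    ~ exists f : mor (aob X1) (aob X2), compatible X1 X2 f /\ f <> 0.

Definition is_HN_category : Prop := HN1 /\ HN2.

End Slope.

(* Main.v *)
(* If [f = j ∘ p : X1 -> I -> X2] is compatible, with [p] epi and [j] mono, then
   the identity of [I] is compatible from the quotient structure of [X1] to the
   substructure of [X2], so condition 2 compares the two slopes on [I].
   For semistable [X1], [X2] this chains to slope X1 <= slope I <= slope X2: HN2.
   For HN1, let [D] be a subobject of maximal slope [M] and [X0] another one not
   contained in [D], and let [W] be the image of [X0] in [X / D].  As a quotient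
   of [X0] it has slope at least [M], hence also as a subobject of [X / D], so
   [D + X0], an extension of [W] by [D], has slope [M] and larger rank than [D].
   Since ranks are bounded by that of [X], this can happen only finitely often. *)
Require Import Defs.
From mathcomp Require Import all_boot all_order all_algebra.
From mathcomp Require Import boolp classical_sets reals constructive_ereal ereal.
From mathcomp Require Import ring_quotient zify lra.

Set Implicit Arguments.
Unset Strict Implicit.
Unset Printing Implicit Defensive.

Import Order.TTheory GRing.Theory Num.Theory.
Local Open Scope ring_scope.
Local Open Scope cat_scope.

(** * Monomorphisms, epimorphisms, kernels and squares in a preadditive category *)

Section Category.
Variable C : preadd.
Implicit Types X Y Z W K Q : C.

Lemma mcompf0 X Y Z (g : mor Y Z) : g ∘ (0 : mor X Y) = 0.
Proof. by apply: (addrI (g ∘ 0)); rewrite -mcompDr !addr0. Qed.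

Lemma mcomp0f X Y Z (f : mor X Y) : (0 : mor Y Z) ∘ f = 0.
Proof. by apply: (addrI (0 ∘ f)); rewrite -mcompDl !addr0. Qed.

Lemma mono_comp X Y Z (g : mor Y Z) (f : mor X Y) :
  mono g -> mono f -> mono (g ∘ f).
Proof. by move=> mg mf T a b; rewrite -!mcompA => /mg /mf. Qed.

Lemma epi_comp X Y Z (g : mor Y Z) (f : mor X Y) :
  epi g -> epi f -> epi (g ∘ f).
Proof. by move=> eg ef T a b; rewrite !mcompA => /ef /eg. Qed.

Lemma mono_right X Y Z (g : mor Y Z) (f : mor X Y) : mono (g ∘ f) -> mono f.
Proof. by move=> m T a b e; apply: m; rewrite -!mcompA e. Qed.

Lemma epi_left X Y Z (g : mor Y Z) (f : mor X Y) : epi (g ∘ f) -> epi g.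
Proof. by move=> m T a b e; apply: m; rewrite !mcompA e. Qed.

Lemma mono_idm X : mono (idm X).
Proof. by move=> T a b; rewrite !mcomp1f. Qed.

Lemma kernel_mono K X Y (i : mor K X) (f : mor X Y) : is_kernel i f -> mono i.
Proof.
move=> [fi0 univ] T a b eab.
have /univ[t [_ tU]] : f ∘ (i ∘ a) = 0 by rewrite mcompA fi0 mcomp0f.
by rewrite -(tU a) // -(tU b).
Qed.

Lemma cokernel_epi X Y Q (p : mor Y Q) (f : mor X Y) : is_cokernel p f -> epi p.
Proof.
move=> [pf0 univ] T a b eab.
have /univ[t [_ tU]] : (a ∘ p) ∘ f = 0 by rewrite -mcompA pf0 mcompf0.
by rewrite -(tU a) // -(tU b).
Qed.

(** Two maps that agree after [q] also agree after [v], because [p] is epi; they then solve the same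
    universal problem and coincide. [cartesian_mono] is the dual. *)
Lemma cocartesian_epi X Y Z W (u : mor X Y) (p : mor X Z) (q : mor Y W)
  (v : mor Z W) : cocartesian u p q v -> epi p -> epi q.
Proof.
move=> [quvp univ] ep T a b eab.
have av_bv : a ∘ v = b ∘ v by apply: ep; rewrite -!mcompA -quvp !mcompA eab.
have /univ[t [_ tU]] : (a ∘ q) ∘ u = (a ∘ v) ∘ p by rewrite -!mcompA quvp.
by rewrite -(tU a) // -(tU b).
Qed.

Lemma cartesian_mono X Y Z W (u : mor X Y) (p : mor X Z) (q : mor Y W)
  (v : mor Z W) : cartesian u p q v -> mono v -> mono u.
Proof.
move=> [quvp univ] mv T a b eab.
have pa_pb : p ∘ a = p ∘ b by apply: mv; rewrite !mcompA -quvp -!mcompA eab.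
have /univ[t [_ tU]] : q ∘ (u ∘ a) = v ∘ (p ∘ a) by rewrite !mcompA quvp.
by rewrite -(tU a) // -(tU b).
Qed.

Lemma zero_mor_eq0 X Y (f : mor X Y) : is_zero Y -> f = 0.
Proof. by move=> /(_ X)[_]; apply. Qed.

Lemma is_zero_idm X : idm X = 0 -> is_zero X.
Proof.
move=> e Y; split=> f; first by rewrite -(mcompf1 f) e mcompf0.
by rewrite -(mcomp1f f) e mcomp0f.
Qed.

Lemma zero_short_exact X : is_zero X -> short_exact (idm X) (idm X).
Proof.
move=> zX; split; split; rewrite ?(zero_mor_eq0 (_ ∘ _) zX) // => T a _.
- exists a; split; first exact: mcomp1f.
  by move=> b; rewrite mcomp1f.
- exists a; split; first exact: mcompf1.
  by move=> b; rewrite mcompf1.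
Qed.

End Category.

(** * Short exact sequences, images and squares in an abelian category *)

Section AbelianExact.
Variables (C : exact_cat) (abC : abelian_exact C).
Implicit Types X Y Z W K Q I : C.

(** Abelianness makes [p] the cokernel of some [l]. Since [l] factors through the kernel [i], every
    map that kills [i] kills [l] and so descends uniquely along [p]. *)
Lemma kernel_conflation K X Q (i : mor K X) (p : mor X Q) :
  is_kernel i p -> epi p -> conflation i p.
Proof.
case: abC => [[_ _ _ coker_epi] confE] ki ep; apply/confE; split=> //.
have [L [l [pl0 univ]]] := coker_epi _ _ _ ep.
split; first by case: ki.
move=> T a ai0; case: ki => _ /(_ _ _ pl0)[m [im _]].
by apply: univ; rewrite -im mcompA ai0 mcomp0f.
Qed.

Lemma cokernel_conflation K X Q (i : mor K X) (p : mor X Q) :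
  is_cokernel p i -> mono i -> conflation i p.
Proof.
case: abC => [[_ _ ker_mono _] confE] cp mi; apply/confE; split=> //.
have [L [l [li0 univ]]] := ker_mono _ _ _ mi.
split; first by case: cp.
move=> T a pa0; case: cp => _ /(_ _ _ li0)[m [mp _]].
by apply: univ; rewrite -mp -mcompA pa0 mcompf0.
Qed.

Lemma conflation_kernel X' X X'' (i : mor X' X) (p : mor X X'') :
  conflation i p -> is_kernel i p.
Proof. by case: abC => _ confE /confE[]. Qed.

Lemma conflation_cokernel X' X X'' (i : mor X' X) (p : mor X X'') :
  conflation i p -> is_cokernel p i.
Proof. by case: abC => _ confE /confE[]. Qed.

Lemma mono_conflation X Y (f : mor X Y) :
  mono f -> exists (Z : C) (g : mor Y Z), conflation f g.
Proof.
move=> mf; case: (abC) => -[_ coker _ _] _.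
by have [Z [g cg]] := coker _ _ f; exists Z, g; apply: cokernel_conflation.
Qed.

Lemma epi_conflation X Y (f : mor X Y) :
  epi f -> exists (Z : C) (g : mor Z X), conflation g f.
Proof.
move=> ef; case: (abC) => -[ker _ _ _] _.
by have [Z [g kg]] := ker _ _ f; exists Z, g; apply: kernel_conflation.
Qed.

Lemma adm_monoP X Y (f : mor X Y) : adm_mono f <-> mono f.
Proof.
split; last exact: mono_conflation.
by case=> Z [g /conflation_kernel/kernel_mono].
Qed.

Lemma adm_epiP X Y (f : mor X Y) : adm_epi f <-> epi f.
Proof.
split; last exact: epi_conflation.
by case=> Z [g /conflation_cokernel/cokernel_epi].
Qed.

(** The image is built as a coimage: [p] is the cokernel of the kernel of [f], so only the
    injectivity of [j] needs an argument. *)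
Lemma image_factorization X Y (f : mor X Y) :
  exists (I : C) (p : mor X I) (j : mor I Y), [/\ epi p, mono j & f = j ∘ p].
Proof.
case: (abC) => -[ker coker _ coker_epi] _.
have [K [k [fk0 kU]]] := ker _ _ f.
have [I [p cp]] := coker _ _ k; have ep := cokernel_epi cp.
case: (cp) => pk0 pU; have [j [jp _]] := pU _ _ fk0.
exists I, p, j; split=> //.
suff j0 T (a : mor T I) : j ∘ a = 0 -> a = 0.
  move=> T a b eab; apply/eqP; rewrite -subr_eq0; apply/eqP/j0.
  rewrite mcompDr eab -mcompDr subrr; exact: mcompf0.
(* With [c] the cokernel of [a], the map [j] factors through [c]. The epi [c ∘ p] is the cokernel of
   some [l]; then [f] kills [l], hence so does [p], and [p] factors through [c ∘ p]. Thus [c] has a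
   left inverse [n], and [c ∘ a = 0] forces [a = 0]. *)
move=> ja0; have [Q [c cc]] := coker _ _ a.
have [L [l cl]] := coker_epi _ _ _ (epi_comp (cokernel_epi cc) ep).
case: (cc) => ca0 /(_ _ _ ja0)[j' [j'c _]]; case: cl => cpl0 clU.
have [m [km _]] : exists! t, k ∘ t = l.
  by apply: kU; rewrite -jp -j'c -!mcompA (mcompA c) cpl0 mcompf0.
have [n [ncp _]] : exists! t, t ∘ (c ∘ p) = p.
  by apply: clU; rewrite -km mcompA pk0 mcomp0f.
have nc : n ∘ c = idm I by apply: ep; rewrite -mcompA ncp mcomp1f.
by rewrite -(mcomp1f a) -nc -mcompA ca0 mcompf0.
Qed.

Lemma pushout_exists X Y Z (u : mor X Y) (p : mor X Z) : mono u -> epi p ->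
  exists (W : C) (q : mor Y W) (v : mor Z W),
    [/\ cocartesian u p q v, mono v & epi q].
Proof.
move=> /adm_monoP mu ep.
have [W [q [v [cc /adm_monoP mv]]]] := ex_pushout (exactP C) p mu.
by exists W, q, v; split=> //; apply: cocartesian_epi cc ep.
Qed.

Lemma pullback_exists Y Z W (q : mor Y W) (v : mor Z W) : epi q -> mono v ->
  exists (X : C) (u : mor X Y) (p : mor X Z),
    [/\ cartesian u p q v, mono u & epi p].
Proof.
move=> /adm_epiP eq mv.
have [X [u [p [cc /adm_epiP ep]]]] := ex_pullback (exactP C) v eq.
by exists X, u, p; split=> //; apply: cartesian_mono cc mv.
Qed.

End AbelianExact.

(** * Transport of arithmetic structures, and compatibility on the image *)

Section CompatibleImage.
Variables (C : exact_cat) (abC : abelian_exact C) (A : arith_structure C).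

Lemma arith_sub_exists (X : arith_obj A) (Y : C) (i : mor Y (aob X)) :
  mono i -> exists hY : A Y, arith_sub (ArithObj hY) X i.
Proof. by move=> /(adm_monoP abC) mi; exists (pull A mi (astr X)), mi. Qed.

Lemma arith_quo_exists (X : arith_obj A) (Z : C) (p : mor (aob X) Z) :
  epi p -> exists hZ : A Z, arith_quo X (ArithObj hZ) p.
Proof. by move=> /(adm_epiP abC) ep; exists (push A ep (astr X)), ep. Qed.

Lemma arith_sub_mono (X Y : arith_obj A) (i : mor (aob Y) (aob X)) :
  arith_sub Y X i -> mono i.
Proof. by case=> mi _; apply/(adm_monoP abC). Qed.

Lemma arith_quo_epi (X Z : arith_obj A) (p : mor (aob X) (aob Z)) :
  arith_quo X Z p -> epi p.
Proof. by case=> ep _; apply/(adm_epiP abC). Qed.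

Lemma arith_sub_trans (X Y Z : arith_obj A) (i : mor (aob X) (aob Y))
    (j : mor (aob Y) (aob Z)) :
  arith_sub X Y i -> arith_sub Y Z j -> arith_sub X Z (j ∘ i).
Proof.
rewrite /arith_sub => -[mi ->] [mj ->].
have mji : adm_mono (j ∘ i) by apply/(adm_monoP abC)/mono_comp; apply/(adm_monoP abC).
by exists mji; rewrite -pull_comp.
Qed.

Lemma arith_sub_factor (X Y Z : arith_obj A) (i : mor (aob X) (aob Y))
    (j : mor (aob Y) (aob Z)) :
  arith_sub X Z (j ∘ i) -> arith_sub Y Z j -> arith_sub X Y i.
Proof.
rewrite /arith_sub => -[mji ->] [mj ->].
have mi : adm_mono i.
  by move/(adm_monoP abC): (mji) => /mono_right /(adm_monoP abC).
by exists mi; rewrite -pull_comp.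
Qed.

Lemma arith_quo_factor (X Y Z : arith_obj A) (p : mor (aob X) (aob Y))
    (q : mor (aob Y) (aob Z)) :
  arith_quo X Z (q ∘ p) -> arith_quo X Y p -> arith_quo Y Z q.
Proof.
rewrite /arith_quo => -[eqp ->] [ep ->].
have eq : adm_epi q.
  by move/(adm_epiP abC): (eqp) => /epi_left /(adm_epiP abC).
by exists eq; rewrite -push_comp.
Qed.

(** This is [base_change] read as a relation: it solves for the edge [v] when the other three edges
    carry their structures. [arith_square_quo] solves the same equation for [p]. *)
Lemma arith_square (X Y Z W : arith_obj A)
    (u : mor (aob X) (aob Y)) (p : mor (aob X) (aob Z))
    (q : mor (aob Y) (aob W)) (v : mor (aob Z) (aob W)) :
  cartesian u p q v \/ cocartesian u p q v ->
  arith_sub X Y u -> arith_quo X Z p -> arith_quo Y W q -> mono v ->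
  arith_sub Z W v.
Proof.
rewrite /arith_sub /arith_quo => sq [mu ->] [ep ->] [eq ->] /(adm_monoP abC) mv.
by exists mv; apply/esym/base_change.
Qed.

Lemma arith_square_quo (X Y Z W : arith_obj A)
    (u : mor (aob X) (aob Y)) (p : mor (aob X) (aob Z))
    (q : mor (aob Y) (aob W)) (v : mor (aob Z) (aob W)) :
  cartesian u p q v \/ cocartesian u p q v ->
  arith_sub X Y u -> arith_quo Y W q -> arith_sub Z W v -> epi p ->
  arith_quo X Z p.
Proof.
rewrite /arith_sub /arith_quo => sq [mu ->] [eq ->] [mv ->] /(adm_epiP abC) ep.
by exists ep; apply: base_change.
Qed.

(* The structure witnessing compatibility of [j ∘ p], carried by [X], is moved
   to the image [I] by pushing out along [p] and then pulling back along [j]. *)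
Lemma compatible_image (X1 X2 : arith_obj A) (I : C) (hI hI' : A I)
    (p : mor (aob X1) I) (j : mor I (aob X2)) :
  compatible X1 X2 (j ∘ p) ->
  arith_quo X1 (ArithObj hI) p -> arith_sub (ArithObj hI') X2 j ->
  compatible (ArithObj hI) (ArithObj hI') (idm I).
Proof.
move=> [X [u [v [jp_vu subu quov]]]] quop subj.
have mu := arith_sub_mono subu; have ep := arith_quo_epi quop.
have ev := arith_quo_epi quov; have mj := arith_sub_mono subj.
have [P [q [v' [cc mv' eq]]]] := pushout_exists abC mu ep.
have [hP quoq] := arith_quo_exists eq.
have subv' : arith_sub (ArithObj hI) (ArithObj hP) v'.
  by apply: (arith_square (Z := ArithObj hI) (W := ArithObj hP) (u := u) (p := p) (q := q)); [right| | | |].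
(* Both [v] on [X] and [j] on [I] extend to the pushout [P]; the resulting [w] is a quotient map
   because [w ∘ q = v] is one. *)
have [w [[wq wv'] _]] := cc.2 _ _ _ (esym jp_vu).
have quow : arith_quo (ArithObj hP) X2 w.
  by apply: (arith_quo_factor (Y := ArithObj hP) (p := q)) => //; rewrite wq.
have ew := arith_quo_epi quow.
have [Q [u' [p' [ca mu' ep']]]] := pullback_exists abC ew mj.
have [hQ subu'] := arith_sub_exists (X := ArithObj hP) mu'.
have quop' : arith_quo (ArithObj hQ) (ArithObj hI') p'.
  by apply: (arith_square_quo (X := ArithObj hQ) (Z := ArithObj hI') (u := u') (q := w) (v := j));
    [left| | | |].
(* The map [s] is a section of [p'] lifting [v'], so [Q] is the object through which the identity of
   [I] is compatible. *)
have /ca.2[s [[u's p's] _]] : w ∘ v' = j ∘ idm I by rewrite mcompf1.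
exists (ArithObj hQ), s, p'; split=> //.
by apply: (arith_sub_factor (Y := ArithObj hQ) (j := u')) => //;
  rewrite u's.
Qed.

End CompatibleImage.

(** * Additivity of degree and rank, and its effect on slopes *)

Lemma K0_class_ses (T : Type) (iso : T -> T -> Prop) (ses : T -> T -> T -> Prop)
    (X' X X'' : T) : ses X' X X'' ->
  K0_class iso ses X = K0_class iso ses X' + K0_class iso ses X''.
Proof.
move=> s; rewrite /K0_class -raddfD /=; apply/eqP; rewrite eqmodE; apply/asboolP.
by move=> S S0 SB SR; apply: SR; exists X', X, X''.
Qed.

Section Slopes.
Variables (R : realType) (C : exact_cat) (A : arith_structure C).
Variables (adeg : {additive K0_arith A -> R}) (rk : {additive K0_exact C -> int}).
Hypotheses (abC : abelian_exact C) (rkP : is_rank rk).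
Implicit Types X Y Z K D : arith_obj A.

Local Notation deg X := (adeg (class_arith X)).
Local Notation rank X := (rk (class_exact (aob X))).

Lemma conflation_deg_rank X' X X'' (i : mor (aob X') (aob X))
    (p : mor (aob X) (aob X'')) :
  conflation i p -> arith_sub X' X i -> arith_quo X X'' p ->
  deg X = deg X' + deg X'' /\ rank X = rank X' + rank X''.
Proof.
move=> cf subi quop; split; rewrite -raddfD; congr (_ _); apply: K0_class_ses.
  by exists i, p.
by exists i, p.
Qed.

(** For a zero object the identity followed by the identity is short exact, so additivity gives
    [deg X = deg X + deg X], and likewise for the rank. *)
Lemma zero_deg_rank X : is_zero (aob X) -> deg X = 0 /\ rank X = 0.
Proof.
move=> zX.
have cf : conflation (idm (aob X)) (idm (aob X)).
  by case: abC => _ confE; apply/confE/zero_short_exact.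
have mi : adm_mono (idm (aob X)) by exists (aob X), (idm (aob X)).
have ei : adm_epi (idm (aob X)) by exists (aob X), (idm (aob X)).
have [||degE rankE] := conflation_deg_rank (X' := X) (X := X) (X'' := X) cf.
- by exists mi; rewrite pull_id.
- by exists ei; rewrite push_id.
by split; [apply: (addrI (deg X)) | apply: (addrI (rank X))]; rewrite -?degE -?rankE addr0.
Qed.

Lemma rank_ge0 X : 0 <= rank X.
Proof.
have [/zero_deg_rank[_ ->//]|nzX] := pselect (is_zero (aob X)).
exact/ltW/rkP.
Qed.

Lemma rank_gt0 X : nonzero X -> 0 < ((rank X)%:~R : R).
Proof. by move=> nzX; rewrite ltr0z; apply: rkP. Qed.

Lemma slope_le X (M : R) : nonzero X ->
  (slope adeg rk X <= M) = (deg X <= M * (rank X)%:~R).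
Proof. by move=> /rank_gt0 r0; rewrite /slope ler_pdivrMr. Qed.

Lemma slope_ge X (M : R) : nonzero X ->
  (M <= slope adeg rk X) = (M * (rank X)%:~R <= deg X).
Proof. by move=> /rank_gt0 r0; rewrite /slope ler_pdivlMr. Qed.

(** Clearing the denominator extends the slope bound to zero subobjects, so it can be applied to a
    kernel that may vanish. *)
Lemma sub_deg_le X (M : R) :
  (forall Y (i : mor (aob Y) (aob X)),
     nonzero Y -> arith_sub Y X i -> slope adeg rk Y <= M) ->
  forall K (k : mor (aob K) (aob X)), arith_sub K X k ->
  deg K <= M * (rank K)%:~R.
Proof.
move=> leM K k subk; have [/zero_deg_rank[-> ->]|nzK] := pselect (is_zero (aob K)).
  by rewrite mulr0.
by rewrite -slope_le //; apply: leM subk.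
Qed.

(** The kernel of [p] is a subobject of [X], so its degree is at most [M] times its rank;
    subtracting this from the bound for [X] leaves the bound for [Z]. *)
Lemma quotient_deg_ge X Z (M : R) (p : mor (aob X) (aob Z)) :
  (forall Y (i : mor (aob Y) (aob X)),
     nonzero Y -> arith_sub Y X i -> slope adeg rk Y <= M) ->
  M * (rank X)%:~R <= deg X -> arith_quo X Z p ->
  M * (rank Z)%:~R <= deg Z.
Proof.
move=> leM geX quop; have [K [k cf]] := epi_conflation abC (arith_quo_epi abC quop).
have [hK subk] : exists hK : A K, arith_sub (ArithObj hK) X k.
  exact/(arith_sub_exists abC)/(kernel_mono (conflation_kernel abC cf)).
have [degE rankE] := conflation_deg_rank (X' := ArithObj hK) cf subk quop.
have := sub_deg_le leM subk.
by move: geX; rewrite degE rankE rmorphD mulrDr /=; lra.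
Qed.

Lemma nonzero_image (X Y I : C) (p : mor X I) (j : mor I Y) :
  j ∘ p <> 0 -> ~ is_zero I.
Proof. by move=> nz zI; apply: nz; rewrite (zero_mor_eq0 p zI) mcompf0. Qed.

(** * Slope comparisons under condition 2 *)

Hypothesis cond2 : forall (X : C) (hX hX' : A X), ~ is_zero X ->
  compatible (ArithObj hX) (ArithObj hX') (idm X) ->
  slope adeg rk (ArithObj hX) <= slope adeg rk (ArithObj hX').

Lemma compatible_slope_le X1 X2 (f : mor (aob X1) (aob X2)) :
  semistable adeg rk X1 -> semistable adeg rk X2 -> compatible X1 X2 f ->
  f <> 0 -> slope adeg rk X1 <= slope adeg rk X2.
Proof.
move=> [nz1 ss1] [nz2 ss2] cf f0.
have [I [p [j [ep mj fjp]]]] := image_factorization abC f.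
rewrite {}fjp in cf f0; have nzI := nonzero_image f0.
have [hI quop] := arith_quo_exists abC ep.
have [hI' subj] := arith_sub_exists abC mj.
have ci := compatible_image abC cf quop subj.
apply: le_trans (ss2 (ArithObj hI') j nzI subj).
apply: le_trans (cond2 nzI ci).
by rewrite slope_ge //; apply: quotient_deg_ge ss1 _ quop; rewrite -slope_ge.
Qed.

(* [W] is the image of [X0] in the quotient of [X] by [D], and [Y] is the
   preimage of [W] in [X]: the sum of [D] and [X0] as subobjects of [X]. *)
Lemma enlarge_max_slope X (M : R) D X0 (i : mor (aob D) (aob X))
    (i0 : mor (aob X0) (aob X)) :
  (forall Y (k : mor (aob Y) (aob X)),
     nonzero Y -> arith_sub Y X k -> slope adeg rk Y <= M) ->
  nonzero D -> arith_sub D X i -> slope adeg rk D = M ->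
  nonzero X0 -> arith_sub X0 X i0 -> slope adeg rk X0 = M ->
  (exists f : mor (aob X0) (aob D), arith_sub X0 D f /\ i ∘ f = i0) \/
  (exists Y (k : mor (aob Y) (aob X)),
     [/\ nonzero Y, arith_sub Y X k, slope adeg rk Y = M & rank D < rank Y]).
Proof.
move=> leM nzD subi slD nz0 sub0 sl0.
have mi := arith_sub_mono abC subi.
have [Q [q cfq]] := mono_conflation abC mi.
have kq := conflation_kernel abC cfq.
have eq := cokernel_epi (conflation_cokernel abC cfq).
have [q0|q0] := pselect (q ∘ i0 = 0).
  left; have [f [fE _]] := kq.2 _ _ q0; exists f; split=> //.
  by apply: (arith_sub_factor abC) subi; rewrite fE.
right; have [W [p [j [ep mj qi0]]]] := image_factorization abC (q ∘ i0).
have nzW : ~ is_zero W by rewrite qi0 in q0; apply: nonzero_image q0.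
have [Y [k [r [ca mk er]]]] := pullback_exists abC eq mj.
have [t [[kt rt] _]] := ca.2 _ _ _ qi0.
have [s [[ks rs] _]] : exists! s : mor (aob D) Y, k ∘ s = i /\ r ∘ s = 0.
  by apply: ca.2; rewrite mcompf0 kq.1.
have [hY subk] := arith_sub_exists abC mk.
have [hW quor] := arith_quo_exists abC (X := ArithObj hY) er.
have [hW' quop] := arith_quo_exists abC (X := X0) ep.
have subs : arith_sub D (ArithObj hY) s.
  by apply: (arith_sub_factor abC) subk; rewrite ks.
have subt : arith_sub X0 (ArithObj hY) t.
  by apply: (arith_sub_factor abC) subk; rewrite kt.
have cfs : conflation s r.
  (* If [r] kills [a], then [q] kills [k ∘ a], which therefore factors through [i = k ∘ s];
     cancelling the mono [k] factors [a] through [s]. *)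
  apply: (kernel_conflation abC) => //; split=> // T a ra0.
  have [b [ib _]] : exists! b, i ∘ b = k ∘ a.
    by apply: kq.2; rewrite mcompA ca.1 -mcompA ra0 mcompf0.
  have sb : s ∘ b = a by apply: mk; rewrite mcompA ks.
  by exists b; split=> // b' sb'; apply: (arith_sub_mono abC subs); rewrite sb.
(* [W] carries two structures, [hW'] as a quotient of [X0] and [hW] as a quotient of [Y]. Since
   [p = r ∘ t], the object [Y] itself witnesses that [p] is compatible from [X0] to [hW]. *)
have cp : compatible (ArithObj hW') (ArithObj hW) (idm W).
  have ei : adm_mono (idm W) by apply/(adm_monoP abC)/mono_idm.
  apply: (compatible_image abC (X1 := X0) (X2 := ArithObj hW) (p := p) (j := idm W)) => //.
    by exists (ArithObj hY), t, r; split=> //; rewrite mcomp1f.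
  by exists ei; rewrite pull_id.
have leM0 Z (l : mor (aob Z) (aob X0)) :
    nonzero Z -> arith_sub Z X0 l -> slope adeg rk Z <= M.
  by move=> nzZ subl; apply: leM nzZ (arith_sub_trans abC subl sub0).
have geW : M <= slope adeg rk (ArithObj hW).
  apply: le_trans (cond2 nzW cp).
  by rewrite slope_ge //; apply: quotient_deg_ge leM0 _ quop; rewrite -slope_ge ?sl0.
have [degE rankE] := conflation_deg_rank (X := ArithObj hY) (X'' := ArithObj hW) cfs subs quor.
have nzY : nonzero (ArithObj hY).
  move=> zY; apply: nzD; apply: is_zero_idm; apply: (arith_sub_mono abC subs).
  by rewrite (zero_mor_eq0 s zY) !mcomp0f.
exists (ArithObj hY), k; split=> //; last by rewrite rankE ltrDl; apply: rkP.
apply/le_anti/andP; split; first exact: leM nzY subk.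
(* Both ends of the extension [s], [r] have slope at least [M]; adding the cleared inequalities
   gives the same for [Y]. *)
have : M <= slope adeg rk D by rewrite slD.
by move: geW; rewrite !slope_ge // degE rankE rmorphD mulrDr /=; lra.
Qed.

(** A given subobject of maximal slope need not contain all the others, so [D] is enlarged until it
    does; the rank of [X] bounds the process. *)
Lemma max_slope_universal X (M : R) D (i : mor (aob D) (aob X)) :
  (forall Y (k : mor (aob Y) (aob X)),
     nonzero Y -> arith_sub Y X k -> slope adeg rk Y <= M) ->
  nonzero D -> arith_sub D X i -> slope adeg rk D = M ->
  exists D' (i' : mor (aob D') (aob X)),
    [/\ nonzero D', arith_sub D' X i', slope adeg rk D' = M &
      forall X0 (i0 : mor (aob X0) (aob X)),
        nonzero X0 -> arith_sub X0 X i0 -> slope adeg rk X0 = M ->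
        exists f : mor (aob X0) (aob D'), arith_sub X0 D' f /\ i' ∘ f = i0].
Proof.
move=> leM nzD subi slD.
have rank_le Y (k : mor (aob Y) (aob X)) : arith_sub Y X k -> rank Y <= rank X.
  move=> subk; have [Q [q cf]] := mono_conflation abC (arith_sub_mono abC subk).
  have [hQ quoq] := arith_quo_exists abC (cokernel_epi (conflation_cokernel abC cf)).
  have [_ ->] := conflation_deg_rank (X'' := ArithObj hQ) cf subk quoq.
  by rewrite lerDl rank_ge0.
(* The induction is on the corank of [D]; the absolute value is harmless since subobjects have rank
   at most [rank X]. *)
have [n] := ubnP `|rank X - rank D|%N.
elim: n D i nzD subi slD => // n IHn D i nzD subi slD leDn.
have [univ|] := pselect (forall X0 (i0 : mor (aob X0) (aob X)),
    nonzero X0 -> arith_sub X0 X i0 -> slope adeg rk X0 = M ->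
    exists f : mor (aob X0) (aob D), arith_sub X0 D f /\ i ∘ f = i0).
  by exists D, i.
move=> /existsNP[X0 /existsNP[i0 /not_implyP[nz0 /not_implyP[sub0 /not_implyP[sl0 nofact]]]]].
have [//|[Y [k [nzY subk slY ltDY]]]] :=
  enlarge_max_slope leM nzD subi slD nz0 sub0 sl0.
apply: (IHn Y k) => //.
have := rank_le _ _ subk; lia.
Qed.

End Slopes.

(** * Verification of the two Harder-Narasimhan conditions *)

Theorem proposition5p8 (R : realType) (C : exact_cat) (A : arith_structure C)
    (adeg : {additive K0_arith A -> R}) (rk : {additive K0_exact C -> int})
    (rkP : is_rank rk)
    (abC : abelian_exact C)
    (cond1 : forall X : arith_obj A, nonzero X ->
       exists (Z : arith_obj A) (i : mor (aob Z) (aob X)),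
         [/\ nonzero Z, arith_sub Z X i &
             (slope adeg rk Z)%:E = ereal_sup (sub_slopes adeg rk X)])
    (cond2 : forall (X : C) (hX hX' : A X), ~ is_zero X ->
       compatible (ArithObj hX) (ArithObj hX') (idm X) ->
       slope adeg rk (ArithObj hX) <= slope adeg rk (ArithObj hX')) :
  is_HN_category adeg rk.
Proof.
split=> [X nzX | X1 X2 ss1 ss2 lt21 [f [cf f0]]]; last first.
  have := compatible_slope_le abC rkP cond2 ss1 ss2 cf f0.
  by rewrite leNgt lt21.
have [Z [i [nzZ subi supE]]] := cond1 X nzX.
(* As the supremum is attained at [Z], it is finite and becomes a real bound
   [M = slope adeg rk Z]. *)
have leM Y (k : mor (aob Y) (aob X)) :
    nonzero Y -> arith_sub Y X k -> slope adeg rk Y <= slope adeg rk Z.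
  move=> nzY subk; rewrite -lee_fin supE; apply: ereal_sup_ubound.
  by exists Y => //; split=> //; exists k.
have [D [j [nzD subj slD univ]]] :=
  max_slope_universal abC rkP cond2 leM nzZ subi erefl.
by exists D, j; rewrite slD; split.
Qed.
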